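(* Let $(X,d)$ be a complete separable metric space with a fixed dense sequence $(x_i)_{i\in\mathbb{N}}$, let $T\colon X\to X$ be continuous and let $u\colon X\to\mathbb{R}$ be uniformly continuous. Let $x\in X$ satisfy $0<\underline{u}(x)\le\overline{u}(x)<\infty$ and let $A\subset\mathbb{N}$ be any oracle. If $\underline{K}^A(x,T)<\infty$, then $\dim^A_{\mathrm{BS}}(x,T,u)$ is the unique solution $s$ of $$\underline{P}^A(x,T,-su)=0,$$ and if $\overline{K}^A(x,T)<\infty$, then $\mathrm{Dim}^A_{\mathrm{BS}}(x,T,u)$ is the unique solution $s$ of $\overline{P}^A(x,T,-su)=0$.
   Context: Dynamics: for $f\colon X\to\mathbb{R}$, $S_nf=\sum_{k=0}^{n-1}f\circ T^k$; $\underline{u}(x)=\liminf_{n\to\infty}\frac1nS_nu(x)$, $\overline{u}(x)=\limsup_{n\to\infty}\frac1nS_nu(x)$; the Bowen ball is $B_n(x,T,\varepsilon)=\{y\in X: d(T^ix,T^iy)<\varepsilon \text{ for } 0\le i<n\}$. Complexity: fix a universal prefix-free oracle machine $U$. For an oracle $A\subset\mathbb{N}$ and a finite binary string $\sigma$, $K^A(\sigma)=\min\{|\tau|: U^A(\tau)=\sigma\}$; natural numbers are identified with strings through a fixed computable coding. All minima below are over indices $i$ with $x_i\in B_n(x,T,\varepsilon)$, and $s$ is real. Orbit complexity: $\underline{K}^A(x,T)=\lim_{\varepsilon\to0}\liminf_{n\to\infty}\min_i\frac{K^A(i)}{n}$, and $\overline{K}^A(x,T)$ is the same with $\limsup_{n\to\infty}$.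 Pointwise pressure, for a uniformly continuous $\varphi\colon X\to\mathbb{R}$: $\underline{P}^A(x,T,\varphi)=\lim_{\varepsilon\to0}\liminf_{n\to\infty}\min_i\frac{K^A(i)+S_n\varphi(x_i)}{n}$, and $\overline{P}^A(x,T,\varphi)$ is the same with $\limsup_{n\to\infty}$. Pointwise BS dimension, for $\underline{u}(x)>0$: $\dim^A_{\mathrm{BS}}(x,T,u)=\lim_{\varepsilon\to0}\liminf_{n\to\infty}\min_i\frac{K^A(i)}{S_nu(x_i)}$, and $\mathrm{Dim}^A_{\mathrm{BS}}(x,T,u)$ is the same with $\limsup_{n\to\infty}$ (for $\varepsilon$ small and $n$ large the denominators are positive). *)

(* Defs.v *)
From HB Require Import structures.
From mathcomp Require Import all_boot all_order all_algebra.
From mathcomp Require Import all_classical all_reals all_analysis.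

Set Implicit Arguments.
Unset Strict Implicit.
Unset Printing Implicit Defensive.

Import Order.TTheory GRing.Theory Num.Theory.
Import numFieldNormedType.Exports.

Local Open Scope classical_set_scope.
Local Open Scope ring_scope.

#[short(type="completeMetricType")]
HB.structure Definition CompleteMetric (R : numDomainType) :=
  {X of Complete X & Metric R X}.

(* Oracle Turing machines.  A machine has a two-way infinite work tape over the
   alphabet {blank, 0, 1} (with [None] as the blank) and a read-only one-way
   infinite oracle tape whose cell [h] holds the truth value of [h \in A].
   Given the state and the two scanned symbols, [delta] returns the next state,
   the symbol to be written, the move of the work head and the move of the
   oracle head, or [None] to halt. *)
Inductive move := MoveLeft | Stay | MoveRight.

Record oracle_machine := OracleMachine {
  nstates : nat;
  delta : 'I_nstates.+1 -> option bool -> bool ->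
          option ('I_nstates.+1 * option bool * move * move) }.

Record config (M : oracle_machine) := Config {
  state : 'I_(nstates M).+1;
  tape : int -> option bool;
  head : int;
  oracle_head : nat }.

Definition move_int (m : move) (z : int) : int :=
  match m with MoveLeft => z - 1 | Stay => z | MoveRight => z + 1 end.

(* a left move at the end of the oracle tape has no effect *)
Definition move_nat (m : move) (n : nat) : nat :=
  match m with MoveLeft => n.-1 | Stay => n | MoveRight => n.+1 end.

Definition step (M : oracle_machine) (A : set nat) (k : config M) :
    option (config M) :=
  if delta (state k) (tape k (head k)) (oracle_head k \in A)
     is Some (q, b, mw, mo) then
    Some (Config q [eta tape k with head k |-> b]
            (move_int mw (head k)) (move_nat mo (oracle_head k)))
  else None.

Definition initial (M : oracle_machine) (tau : seq bool) : config M :=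
  Config ord0 (fun z => if z is Posz j then onth tau j else None) 0 0.

(* [M]^[A]([tau]) = [sigma]: the run on [tau] halts, with [sigma] on the work
   tape from the head up to the first blank ([onth sigma (size sigma)] is
   [None]). *)
Definition computes (M : oracle_machine) (A : set nat) (tau sigma : seq bool) :=
  exists (t : nat) (k : config M),
    [/\ iter t (obind (step A)) (Some (initial M tau)) = Some k,
        step A k = None &
        forall j : nat, (j <= size sigma)%N ->
          tape k (head k + j%:Z) = onth sigma j].

Definition prefix_free (M : oracle_machine) :=
  forall (A : set nat) (tau tau' sigma sigma' : seq bool),
    computes M A tau sigma -> computes M A tau' sigma' ->
    prefix tau tau' -> tau = tau'.

Definition universal_prefix_free (U : oracle_machine) :=
  prefix_free U /\
  forall M : oracle_machine, prefix_free M ->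
    exists rho : seq bool, forall (A : set nat) (tau sigma : seq bool),
      computes U A (rho ++ tau) sigma <-> computes M A tau sigma.

(* The machine is run on the unary representation of [n] and with the empty
   oracle, i.e. it makes no use of an oracle. *)
Definition computable_coding (c : nat -> seq bool) :=
  injective c /\
  exists M : oracle_machine,
    forall n : nat, computes M set0 (nseq n true) (c n).

(* The infimum of a set of lengths is a minimum, and is [+oo] if the set is
   empty (which does not happen when [U] is universal). *)
Definition string_complexity (R : realType) (U : oracle_machine) (A : set nat)
    (sigma : seq bool) : \bar R :=
  ereal_inf [set (size tau)%:R%:E | tau in [set tau | computes U A tau sigma]].

Definition complexity (R : realType) (U : oracle_machine) (c : nat -> seq bool)
    (A : set nat) (i : nat) : \bar R :=
  string_complexity R U A (c i).

Definition birkhoff_sum (R : realType) (X : Type) (T : X -> X) (f : X -> R)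
    (n : nat) (x : X) : R :=
  \sum_(k < n) f (iter k T x).

Definition lower_average (R : realType) (X : Type) (T : X -> X) (u : X -> R)
    (x : X) : \bar R :=
  limn_einf (fun n => (n%:R^-1 * birkhoff_sum T u n x)%:E).

Definition upper_average (R : realType) (X : Type) (T : X -> X) (u : X -> R)
    (x : X) : \bar R :=
  limn_esup (fun n => (n%:R^-1 * birkhoff_sum T u n x)%:E).

Definition bowen_ball (R : realType) (X : metricType R) (n : nat) (x : X)
    (T : X -> X) (e : R) : set X :=
  [set y | forall i, (i < n)%N -> mdist (iter i T x) (iter i T y) < e].

(* Minimum of [F n i] over the indices [i] such that [xs i] lies in the Bowen
   ball, taken as an infimum in the extended reals so that it is meaningful for
   all [e] and [n].  For the three choices of [F] below it is attained once [e]
   is small (and, for the BS dimensions, [n] is large enough for the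
   denominators to be positive), since only finitely many indices have
   complexity below a given bound. *)
Definition bowen_min (R : realType) (X : metricType R) (xs : nat -> X)
    (T : X -> X) (x : X) (F : nat -> nat -> \bar R) (e : R) (n : nat) : \bar R :=
  ereal_inf [set F n i | i in [set i | bowen_ball n x T e (xs i)]].

Definition lower_limit (R : realType) (G : R -> nat -> \bar R) : \bar R :=
  lim (limn_einf (G e) @[e --> 0^'+]).

Definition upper_limit (R : realType) (G : R -> nat -> \bar R) : \bar R :=
  lim (limn_esup (G e) @[e --> 0^'+]).

Section pointwise_quantities.
Local Open Scope ereal_scope.

Definition lower_orbit_complexity (R : realType) (X : metricType R)
    (xs : nat -> X) (U : oracle_machine) (c : nat -> seq bool) (A : set nat)
    (x : X) (T : X -> X) : \bar R :=
  lower_limit (bowen_min xs T x (fun n i => complexity R U c A i / n%:R%:E)).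

Definition upper_orbit_complexity (R : realType) (X : metricType R)
    (xs : nat -> X) (U : oracle_machine) (c : nat -> seq bool) (A : set nat)
    (x : X) (T : X -> X) : \bar R :=
  upper_limit (bowen_min xs T x (fun n i => complexity R U c A i / n%:R%:E)).

Definition lower_pressure (R : realType) (X : metricType R)
    (xs : nat -> X) (U : oracle_machine) (c : nat -> seq bool) (A : set nat)
    (x : X) (T : X -> X) (phi : X -> R) : \bar R :=
  lower_limit (bowen_min xs T x (fun n i =>
    (complexity R U c A i + (birkhoff_sum T phi n (xs i))%:E) / n%:R%:E)).

Definition upper_pressure (R : realType) (X : metricType R)
    (xs : nat -> X) (U : oracle_machine) (c : nat -> seq bool) (A : set nat)
    (x : X) (T : X -> X) (phi : X -> R) : \bar R :=
  upper_limit (bowen_min xs T x (fun n i =>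
    (complexity R U c A i + (birkhoff_sum T phi n (xs i))%:E) / n%:R%:E)).

Definition lower_BS_dim (R : realType) (X : metricType R)
    (xs : nat -> X) (U : oracle_machine) (c : nat -> seq bool) (A : set nat)
    (x : X) (T : X -> X) (u : X -> R) : \bar R :=
  lower_limit (bowen_min xs T x (fun n i =>
    complexity R U c A i / (birkhoff_sum T u n (xs i))%:E)).

Definition upper_BS_dim (R : realType) (X : metricType R)
    (xs : nat -> X) (U : oracle_machine) (c : nat -> seq bool) (A : set nat)
    (x : X) (T : X -> X) (u : X -> R) : \bar R :=
  upper_limit (bowen_min xs T x (fun n i =>
    complexity R U c A i / (birkhoff_sum T u n (xs i))%:E)).

End pointwise_quantities.

(* Main.v *)
Require Import Defs.
From mathcomp Require Import all_boot all_order all_algebra.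
From mathcomp Require Import all_classical all_reals all_analysis.
From mathcomp Require Import ring lra.

(** Write K for the complexity of an index, S for the Birkhoff sum of [u] over
    the first n points of the orbit of [xs i], and D for the BS dimension.  For
    a single index,

      (K - t * S) / n = (S / n) * (K / S - t),

    so the pressure at t is built from the same quotients K / S as D, shifted by
    t and multiplied by the weights S / n.  As [u] is uniformly continuous and
    its averages along the orbit of [x] are positive and bounded, there are
    constants 0 < b0 and b1 with b0 <= S / n <= b1 for every index in a Bowen
    ball of small radius and every large n ([birkhoff_sum_average_bounds]).  Such
    weights preserve signs up to bounded factors: a threshold y with K / S > y
    bounds the pressure term below by (S / n) * (y - t), and one with K / S < y
    bounds it above by the same product.  With y between t and D, the pressure
    is positive if t < D and negative if D < t; if t = D, letting y tend to D
    from both sides gives pressure 0.  Hence D is the only zero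
    ([pressure_root]).  The orbit complexity makes D finite, through
    K / S <= (K / n) / b0 ([dim_fin_num]).

    All that passes from single indices to the limits is implications of the
    form F < y -> G <= z, or y < F -> z <= G: they carry over to minima over
    Bowen balls, then to the limit in n, then to the limit in the radius
    ([bowen_limit_below], [bowen_limit_above]).  The lower and the upper limit
    in n both allow this, so one proof covers the two halves of the theorem
    ([limit_operation]). *)

Set Implicit Arguments.
Unset Strict Implicit.
Unset Printing Implicit Defensive.

Import Order.TTheory GRing.Theory Num.Theory.
Import numFieldNormedType.Exports.

Local Open Scope classical_set_scope.
Local Open Scope ring_scope.

(** * Lower and upper limits as threshold-preserving operations *)

(** The last two clauses hold because [L v < y] forces [v n < y] for infinitely
    many n when [L] is the lower limit and for all large n when it is the upper
    limit, and because conversely bounds on [w n] at just these n bound [L w];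
    the clause for [y < L v] is symmetric. *)
Definition limit_operation (R : realType) (L : (nat -> \bar R) -> \bar R) :=
  [/\ forall v w, (\forall n \near \oo, (v n <= w n)%E) -> (L v <= L w)%E,
      forall z, L (cst z) = z,
      forall v w y z, (\forall n \near \oo, (v n < y)%E -> (w n <= z)%E) ->
        (L v < y)%E -> (L w <= z)%E &
      forall v w y z, (\forall n \near \oo, (y < v n)%E -> (z <= w n)%E) ->
        (y < L v)%E -> (z <= L w)%E].

Lemma limit_operation_limn_esup (R : realType) :
  @limit_operation R (@limn_esup R).
Proof.
split => [v w vw|z|v w y z vw|v w y z vw].
- apply: le_ereal_inf_tmp => _ [V Voo <-].
  apply: (@le_trans _ _ (ereal_sup (v @` (V `&` [set n | (v n <= w n)%E])))).
    by apply: ereal_inf_lbound; exists (V `&` [set n | (v n <= w n)%E]) => //;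
      exact: (filterI Voo vw).
  apply: ge_ereal_sup => _ [n [Vn /= vwn] <-]; apply: le_trans vwn _.
  by apply: ereal_sup_ubound; exists n.
- by have [_ ->] := cvg_limn_einf_sup (cvg_cst z).
- move=> /ereal_inf_lt[_ [V Voo <-]] supVy.
  apply: (@le_trans _ _ (ereal_sup
    (w @` (V `&` [set n | (v n < y)%E -> (w n <= z)%E])))).
    by apply: ereal_inf_lbound;
      exists (V `&` [set n | (v n < y)%E -> (w n <= z)%E]) => //; exact: (filterI Voo vw).
  apply: ge_ereal_sup => _ [n [Vn /= vwn] <-]; apply: vwn.
  by apply: le_lt_trans supVy; apply: ereal_sup_ubound; exists n.
- move=> yv; apply: le_ereal_inf_tmp => _ [V Voo <-].
  have /ereal_sup_gt[_ [n [Vn /= vwn] <-] yvn] : (y < ereal_sup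
      (v @` (V `&` [set n | (y < v n)%E -> (z <= w n)%E])))%E.
    apply: lt_le_trans yv _; apply: ereal_inf_lbound.
    by exists (V `&` [set n | (y < v n)%E -> (z <= w n)%E]) => //; exact: (filterI Voo vw).
  by apply: le_trans (vwn yvn) _; apply: ereal_sup_ubound; exists n.
Qed.

(** The four clauses are stable under conjugation by the opposite, which
    exchanges the last two. *)
Lemma limit_operation_limn_einf (R : realType) :
  @limit_operation R (@limn_einf R).
Proof.
have [mono const below above] := limit_operation_limn_esup R.
split => [v w vw|z|v w y z vw|v w y z vw]; rewrite /limn_einf.
- by rewrite leeN2; apply: mono; apply: filterS vw => n; rewrite leeN2.
- by rewrite (const (- z)%E) oppeK.
- rewrite lteNl leeNl; apply: above.
  by apply: filterS vw => n; rewrite lteN2 leeN2.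
- rewrite lteNr leeNr; apply: below.
  by apply: filterS vw => n; rewrite lteN2 leeN2.
Qed.

(** * Limits of minima over shrinking Bowen balls *)

Section bowen_limits.
Context {R : realType} {X : metricType R} (xs : nat -> X) (T : X -> X) (x : X).
Context (L : (nat -> \bar R) -> \bar R) (L_op : limit_operation L).
Implicit Types F G : nat -> nat -> \bar R.

Let bowen_limit F : \bar R := lim (L (bowen_min xs T x F e) @[e --> 0^'+]).

Lemma bowen_min_antitone F (e e' : R) (n : nat) : e <= e' ->
  (bowen_min xs T x F e' n <= bowen_min xs T x F e n)%E.
Proof.
move=> ee'; apply: ereal_inf_le_tmp => _ [i /= xi <-]; exists i => // j jn.
exact: lt_le_trans (xi j jn) ee'.
Qed.

Lemma limit_bowen_min_antitone F (e e' : R) : e <= e' ->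
  (L (bowen_min xs T x F e') <= L (bowen_min xs T x F e))%E.
Proof.
have [mono _ _ _] := L_op => ee'; apply: mono; apply: nearW => n.
exact: bowen_min_antitone.
Qed.

(** Smaller Bowen balls have larger minima, so the limit at radius 0 exists and
    is a supremum; this turns both bounds below into statements about a single
    radius. *)
Lemma bowen_limitE F : bowen_limit F =
  ereal_sup [set L (bowen_min xs T x F e) | e in `]0, +oo[].
Proof.
apply: cvg_lim => //.
apply: (@nonincreasing_at_right_cvge _ _ _ +oo%O) => // e e' _ _.
exact: limit_bowen_min_antitone.
Qed.

(** A minimum over a Bowen ball that is [< y] comes from an index of the ball
    with [F n i < y], and [G n i] at this index bounds the other minimum.  The
    hypothesis concerns the balls of radius [e0]; it applies to smaller radii
    because their balls are contained in these, and to larger radii because the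
    minima are then smaller. *)
Lemma bowen_limit_below F G (e0 : R) (y z : \bar R) : 0 < e0 ->
  (\forall n \near \oo, forall i, bowen_ball n x T e0 (xs i) ->
     (F n i < y)%E -> (G n i <= z)%E) ->
  (bowen_limit F < y)%E -> (bowen_limit G <= z)%E.
Proof.
have [_ _ below _] := L_op => e0_gt0 FG; rewrite !bowen_limitE => Fy.
apply: ge_ereal_sup => y' [e /=]; rewrite in_itv/= andbT => e_gt0 <-.
have m_gt0 : 0 < Num.min e e0 by rewrite lt_min e_gt0.
apply: (@le_trans _ _ (L (bowen_min xs T x G (Num.min e e0)))).
  by apply: limit_bowen_min_antitone; rewrite ge_min lexx.
apply: (below (bowen_min xs T x F (Num.min e e0)) _ y); last first.
  apply: le_lt_trans Fy; apply: ereal_sup_ubound.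
  by exists (Num.min e e0) => //=; rewrite in_itv/= m_gt0.
apply: filterS FG => n {}FG /ereal_inf_lt[_ [i xi <-] Fi].
apply: le_trans (FG i _ Fi).
  by apply: ereal_inf_lbound; exists i.
by move=> j jn; apply: lt_le_trans (xi j jn) _; rewrite ge_min lexx orbT.
Qed.

(** Dual to [bowen_limit_below]: a minimum that is [> y] has [y < F n i] at
    every index of the ball.  A supremum over radii that exceeds [y] already
    does so at some radius, which may be taken smaller than [e0]. *)
Lemma bowen_limit_above F G (e0 : R) (y z : \bar R) : 0 < e0 ->
  (\forall n \near \oo, forall i, bowen_ball n x T e0 (xs i) ->
     (y < F n i)%E -> (z <= G n i)%E) ->
  (y < bowen_limit F)%E -> (z <= bowen_limit G)%E.
Proof.
have [_ _ _ above] := L_op => e0_gt0 FG; rewrite !bowen_limitE.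
move=> /ereal_sup_gt[y' [e /=]]; rewrite in_itv/= andbT => e_gt0 <- yF.
have m_gt0 : 0 < Num.min e e0 by rewrite lt_min e_gt0.
apply: (@le_trans _ _ (L (bowen_min xs T x G (Num.min e e0)))); last first.
  apply: ereal_sup_ubound.
  by exists (Num.min e e0) => //=; rewrite in_itv/= m_gt0.
apply: (above (bowen_min xs T x F (Num.min e e0)) _ y); last first.
  apply: lt_le_trans yF _; apply: limit_bowen_min_antitone.
  by rewrite ge_min lexx.
apply: filterS FG => n {}FG yFn; apply: le_ereal_inf_tmp => _ [i xi <-].
apply: FG; last by apply: lt_le_trans yFn _; apply: ereal_inf_lbound; exists i.
by move=> j jn; apply: lt_le_trans (xi j jn) _; rewrite ge_min lexx orbT.
Qed.

Lemma bowen_limit_ge F (e0 : R) (z : \bar R) : 0 < e0 ->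
  (\forall n \near \oo, forall i, bowen_ball n x T e0 (xs i) ->
     (z <= F n i)%E) ->
  (z <= bowen_limit F)%E.
Proof.
have [mono const _ _] := L_op => e0_gt0 zF; rewrite bowen_limitE.
apply: (@le_trans _ _ (L (bowen_min xs T x F e0))); last first.
  by apply: ereal_sup_ubound; exists e0 => //=; rewrite in_itv/= e0_gt0.
rewrite -[leLHS]const; apply: mono; apply: filterS zF => n {}zF.
by apply: le_ereal_inf_tmp => _ [i xi <-]; exact: zF.
Qed.

End bowen_limits.

(** * The pressure changes sign exactly at the BS dimension *)

Lemma complexity_ge0 (R : realType) (U : oracle_machine) (c : nat -> seq bool)
  (A : set nat) (i : nat) : (0 <= complexity R U c A i)%E.
Proof. by apply: le_ereal_inf_tmp => _ [tau _ <-]; rewrite lee_fin. Qed.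

(** The identity behind the theorem.  When [K] is infinite, both sides are
    [+oo]. *)
Lemma pressure_factor (R : realType) (K : \bar R) (S m t : R) :
  (0 <= K)%E -> 0 < S -> 0 < m ->
  ((K + (- t * S)%:E) / m%:E = (S / m)%:E * (K / S%:E - t%:E))%E.
Proof.
move=> K_ge0 S_gt0 m_gt0; have Sm_gt0 : 0 < S / m by rewrite divr_gt0.
rewrite !inver !gt_eqF//; case: K K_ge0 => [k _| _ |//].
  by rewrite -!(EFinM, EFinD, EFinN); congr EFin; field; rewrite !gt_eqF.
by rewrite addye// !gt0_mulye ?lte_fin ?invr_gt0// addye// gt0_muley ?lte_fin.
Qed.

(** The nature of the costs [K] and of the sums [S] is left open: beyond
    nonnegative costs, the comparison of dimension and pressure rests on [S n i]
    being comparable to n on the Bowen balls of radius [e0]. *)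
Section root_of_pressure.
Context {R : realType} {X : metricType R} (xs : nat -> X) (T : X -> X) (x : X).
Context (L : (nat -> \bar R) -> \bar R) (L_op : limit_operation L).
Context (K : nat -> \bar R) (S : nat -> nat -> R) (e0 b0 b1 : R).
Hypotheses (K_ge0 : forall i, (0 <= K i)%E) (e0_gt0 : 0 < e0) (b0_gt0 : 0 < b0).
Hypothesis S_bounds : \forall n \near \oo, forall i,
  bowen_ball n x T e0 (xs i) -> b0 * n%:R <= S n i <= b1 * n%:R.

Let bowen_limit (F : nat -> nat -> \bar R) : \bar R :=
  lim (L (bowen_min xs T x F e) @[e --> 0^'+]).
Let orbit := bowen_limit (fun n i => K i / n%:R%:E)%E.
Let dim := bowen_limit (fun n i => K i / (S n i)%:E)%E.
Let pressure t :=
  bowen_limit (fun n i => (K i + (- t * S n i)%:E) / n%:R%:E)%E.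

Lemma S_average_bounds : \forall n \near \oo, (0 < n)%N /\ forall i,
  bowen_ball n x T e0 (xs i) -> 0 < S n i /\ b0 <= S n i / n%:R <= b1.
Proof.
near=> n; have n_gt0 : (0 < n)%N by near: n; exact: nbhs_infty_gt.
have nR_gt0 : 0 < n%:R :> R by rewrite ltr0n.
split=> // i xi; have /(_ i xi)/andP[bS Sb] : forall i,
  bowen_ball n x T e0 (xs i) -> b0 * n%:R <= S n i <= b1 * n%:R by near: n.
split; first by apply: lt_le_trans bS; rewrite mulr_gt0.
by rewrite ler_pdivlMr// ler_pdivrMr// bS.
Unshelve. all: by end_near. Qed.

(** Since [b0 * n <= S n i], an index with [K i / n < r] has
    [K i / S n i <= r / b0]; nonnegative costs bound the dimension below. *)
Lemma dim_fin_num : (orbit < +oo)%E -> dim \is a fin_num.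
Proof.
move=> orbit_fin; rewrite ge0_fin_numE; last first.
  apply: (bowen_limit_ge L_op e0_gt0).
  apply: filterS S_average_bounds => n [_ Sn] i /Sn[S_gt0 _].
  by rewrite mule_ge0// inve_ge0 lee_fin ltW.
have [r orbit_r] : exists r : R, (orbit < r%:E)%E.
  case: orbit orbit_fin => [r _| //|_]; last by exists 0; rewrite ltNyr.
  by exists (r + 1); rewrite lte_fin ltrDl.
apply: le_lt_trans (ltry (r / b0)).
apply: (bowen_limit_below L_op e0_gt0 _ orbit_r).
apply: filterS S_average_bounds => n [n_gt0 Sn] i /Sn[S_gt0 /andP[bS _]].
have nR_gt0 : 0 < n%:R :> R by rewrite ltr0n.
rewrite !inver !gt_eqF//; case: (K i) (K_ge0 i) => [k k_ge0|_|//]; last first.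
  by rewrite gt0_mulye ?lte_fin ?invr_gt0.
rewrite -!EFinM lte_fin !lee_fin in k_ge0 * => /ltW knr.
rewrite ler_pdivrMr// mulrAC ler_pdivlMr//.
rewrite ler_pdivlMr// in bS; rewrite ler_pdivrMr// in knr.
have r_ge0 : 0 <= r by rewrite -(pmulr_lge0 _ nR_gt0) (le_trans k_ge0).
by nra.
Qed.

(** The sign of [y - t] decides which weight makes [b * (y - t)] largest, so the
    bound is required for all weights and the extreme one is left to the
    caller. *)
Lemma pressure_le (y t c : R) : (dim < y%:E)%E ->
  (forall b, b0 <= b <= b1 -> b * (y - t) <= c) -> (pressure t <= c%:E)%E.
Proof.
move=> dim_y yc; apply: (bowen_limit_below L_op e0_gt0 _ dim_y).
apply: filterS S_average_bounds => n [n_gt0 Sn] i /Sn[S_gt0 bSb] KSy.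
rewrite pressure_factor ?ltr0n//.
apply: (@le_trans _ _ (S n i / n%:R * (y - t))%:E).
  rewrite (EFinM (S n i / n%:R)) lee_pmul2l ?lte_fin ?divr_gt0 ?ltr0n//.
  by rewrite EFinB leeD2r// ltW.
by rewrite lee_fin yc.
Qed.

Lemma pressure_ge (y t c : R) : (y%:E < dim)%E ->
  (forall b, b0 <= b <= b1 -> c <= b * (y - t)) -> (c%:E <= pressure t)%E.
Proof.
move=> dim_y yc; apply: (bowen_limit_above L_op e0_gt0 _ dim_y).
apply: filterS S_average_bounds => n [n_gt0 Sn] i /Sn[S_gt0 bSb] yKS.
rewrite pressure_factor ?ltr0n//.
apply: (@le_trans _ _ (S n i / n%:R * (y - t))%:E).
  by rewrite lee_fin yc.
rewrite (EFinM (S n i / n%:R)) lee_pmul2l ?lte_fin ?divr_gt0 ?ltr0n//.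
by rewrite EFinB leeD2r// ltW.
Qed.

(** Off the dimension [s], the midpoint of [s] and [t] is a threshold on the
    same side of [t] as [s], and the weight [b0] bounds the pressure away from
    0.  At [s], the thresholds are [s + d] and [s - d] with [d] so small that
    every weight times [d] is at most a given [e]. *)
Lemma pressure_root : (orbit < +oo)%E ->
  exists s : R, dim = s%:E /\ unique (fun t => pressure t = 0%E) s.
Proof.
move=> /dim_fin_num/fineK; set s := fine dim => dimE; exists s; split=> //.
split; last first.
  move=> t Pt0; apply/eqP; case: ltgtP => // st; exfalso.
  - have : (pressure t <= (b0 * ((s + t) / 2 - t))%:E)%E.
      apply: (@pressure_le ((s + t) / 2)); first by rewrite -dimE lte_fin; lra.
      by move=> b /andP[b0b _]; nra.
    by rewrite Pt0 lee_fin pmulr_rge0//; lra.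
  - have : ((b0 * ((s + t) / 2 - t))%:E <= pressure t)%E.
      apply: (@pressure_ge ((s + t) / 2)); first by rewrite -dimE lte_fin; lra.
      by move=> b /andP[b0b _]; nra.
    by rewrite Pt0 lee_fin pmulr_rle0//; lra.
(* [`|b1| + 1] is a positive upper bound of the weights: without an index in
   the Bowen balls, nothing forces [b1] itself to be positive. *)
have c1_gt0 : 0 < `|b1| + 1 by rewrite ltr_wpDl.
have b_le b : b0 <= b <= b1 -> 0 <= b <= `|b1| + 1.
  move=> /andP[b0b bb1]; rewrite (le_trans (ltW b0_gt0) b0b)/=.
  by rewrite (le_trans bb1)// ler_wpDr// ler_norm.
apply/eqP; rewrite eq_le; apply/andP; split.
- apply/lee_addgt0Pr => e e_gt0; rewrite add0e.
  apply: (@pressure_le (s + e / (`|b1| + 1))).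
    by rewrite -dimE lte_fin ltrDl divr_gt0.
  move=> b /b_le/andP[b_ge0 bb1].
  by rewrite addrC addKr mulrCA ger_pMr// ler_pdivrMr// mul1r.
- apply/lee_addgt0Pr => e e_gt0; rewrite -leeBlDr// sub0e -EFinN.
  apply: (@pressure_ge (s - e / (`|b1| + 1))).
    by rewrite -dimE lte_fin ltrBlDr ltrDl divr_gt0.
  move=> b /b_le/andP[b_ge0 bb1].
  rewrite addrC addKr mulrN lerN2.
  by rewrite mulrCA ger_pMr// ler_pdivrMr// mul1r.
Qed.

End root_of_pressure.

(** * Birkhoff averages on Bowen balls *)

Lemma birkhoff_sumZ (R : realType) (X : Type) (T : X -> X) (u : X -> R)
  (a : R) (n : nat) (y : X) :
  birkhoff_sum T (fun y => a * u y) n y = a * birkhoff_sum T u n y.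
Proof. by rewrite /birkhoff_sum mulr_sumr. Qed.

Lemma birkhoff_sum_bowen_ball (R : realType) (X : metricType R) (T : X -> X)
    (u : X -> R) (e d : R) (n : nat) (x y : X) :
  (forall a b, mdist a b < d -> `|u a - u b| < e) -> bowen_ball n x T d y ->
  `|birkhoff_sum T u n x - birkhoff_sum T u n y| <= e * n%:R.
Proof.
move=> ued xy; rewrite /birkhoff_sum -sumrB; apply: le_trans (ler_norm_sum _ _ _) _.
apply: (@le_trans _ _ (\sum_(k < n) e)); last first.
  by rewrite sumr_const card_ord mulr_natr.
by apply: ler_sum => k _; apply/ltW/ued/xy.
Qed.

(** Take [l] positive and below the lower average, [h] above the upper average,
    and [d] such that [u] varies by less than [l / 2] within distance [d].  Two
    orbits that stay [d]-close then have averages that differ by at most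
    [l / 2], which keeps the averages on the Bowen ball above [l / 2] and below
    [h + l / 2]. *)
Lemma birkhoff_sum_average_bounds (R : realType) (X : metricType R)
    (T : X -> X) (u : X -> R) (x : X) : unif_continuous u ->
  (0 < lower_average T u x)%E -> (upper_average T u x < +oo)%E ->
  exists e0 b0 b1 : R, [/\ 0 < e0, 0 < b0 &
    \forall n \near \oo, forall y, bowen_ball n x T e0 y ->
      b0 * n%:R <= birkhoff_sum T u n y <= b1 * n%:R].
Proof.
move=> u_ucont low_gt0 up_fin.
have [l l_gt0 low_l] : exists2 l : R, 0 < l & (l%:E < lower_average T u x)%E.
  case: (lower_average T u x) low_gt0 => [r r_gt0|_|//].
    by exists (r / 2); rewrite ?lte_fin in r_gt0 *; lra.
  by exists 1; rewrite // ltry.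
have [h up_h] : exists h : R, (upper_average T u x < h%:E)%E.
  case: (upper_average T u x) up_fin => [r _| //|_]; last by exists 0; rewrite ltNyr.
  by exists (r + 1); rewrite lte_fin; lra.
have l2_gt0 : 0 < l / 2 by lra.
have /unif_continuousP/(_ _ l2_gt0)[d d_gt0 ud] := u_ucont.
exists d, (l / 2), (h + l / 2); split=> //.
have ud' a b : mdist a b < d -> `|u a - u b| < l / 2.
  by move=> ab; have /= := ud (a, b); rewrite ballEmdist; apply.
have up : \forall n \near \oo,
    ((n%:R^-1 * birkhoff_sum T u n x)%:E < h%:E)%E.
  move: up_h => /ereal_inf_lt[_ [V Voo <-]] supV.
  apply: filterS Voo => n Vn; apply: le_lt_trans supV.
  by apply: ereal_sup_ubound; exists n.
have low : \forall n \near \oo,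
    (l%:E < (n%:R^-1 * birkhoff_sum T u n x)%:E)%E.
  move: low_l; rewrite /lower_average /limn_einf lteNr.
  move=> /ereal_inf_lt[_ [V Voo <-]] supV.
  apply: filterS Voo => n Vn; rewrite -lteN2; apply: le_lt_trans supV.
  by apply: ereal_sup_ubound; exists n.
near=> n => y xy.
have n_gt0 : 0 < n%:R :> R by rewrite ltr0n; near: n; exact: nbhs_infty_gt.
have := birkhoff_sum_bowen_ball ud' xy; rewrite ler_norml => /andP[xy1 xy2].
have : ((n%:R^-1 * birkhoff_sum T u n x)%:E < h%:E)%E by near: n.
have : (l%:E < (n%:R^-1 * birkhoff_sum T u n x)%:E)%E by near: n.
rewrite !lte_fin mulrC ltr_pdivlMr// ltr_pdivrMr// => lx xh.
by apply/andP; split; nra.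
Unshelve. all: by end_near. Qed.

(** * The BS dimensions as the zeros of the pressures *)

Theorem theorem3 (R : realType) (X : completeMetricType R) (xs : nat -> X)
    (xs_dense : dense (range xs))
    (T : X -> X) (T_cont : continuous T)
    (u : X -> R) (u_ucont : unif_continuous u)
    (U : oracle_machine) (U_univ : universal_prefix_free U)
    (c : nat -> seq bool) (c_coding : computable_coding c)
    (x : X)
    (u_pos : (0 < lower_average T u x <= upper_average T u x)%E)
    (u_fin : (upper_average T u x < +oo)%E)
    (A : set nat) :
  ((lower_orbit_complexity xs U c A x T < +oo)%E ->
     exists s : R, lower_BS_dim xs U c A x T u = s%:E /\
       unique (fun t : R =>
         lower_pressure xs U c A x T (fun y => - t * u y) = 0%E) s) /\
  ((upper_orbit_complexity xs U c A x T < +oo)%E ->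
     exists s : R, upper_BS_dim xs U c A x T u = s%:E /\
       unique (fun t : R =>
         upper_pressure xs U c A x T (fun y => - t * u y) = 0%E) s).
Proof.
have /andP[low_gt0 _] := u_pos.
have [e0 [b0 [b1 [e0_gt0 b0_gt0 bounds]]]] :=
  birkhoff_sum_average_bounds u_ucont low_gt0 u_fin.
have S_bounds : \forall n \near \oo, forall i, bowen_ball n x T e0 (xs i) ->
    b0 * n%:R <= birkhoff_sum T u n (xs i) <= b1 * n%:R.
  by apply: filterS bounds => n + i; exact.
have pressureE t : (fun n i => (complexity R U c A i +
      (birkhoff_sum T (fun y => - t * u y)%R n (xs i))%:E) / n%:R%:E)%E =
    (fun n i => (complexity R U c A i +
      (- t * birkhoff_sum T u n (xs i))%:E) / n%:R%:E)%E.
  by apply/funext => n; apply/funext => i; rewrite birkhoff_sumZ.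
split=> [low_fin|up_fin].
- have [s [dimE [Ps uniq_s]]] := pressure_root (limit_operation_limn_einf R)
    (@complexity_ge0 R U c A) e0_gt0 b0_gt0 S_bounds low_fin.
  exists s; split; first exact: dimE.
  split; rewrite /lower_pressure; first by rewrite pressureE; exact: Ps.
  by move=> t; rewrite pressureE; exact: uniq_s.
- have [s [dimE [Ps uniq_s]]] := pressure_root (limit_operation_limn_esup R)
    (@complexity_ge0 R U c A) e0_gt0 b0_gt0 S_bounds up_fin.
  exists s; split; first exact: dimE.
  split; rewrite /upper_pressure; first by rewrite pressureE; exact: Ps.
  by move=> t; rewrite pressureE; exact: uniq_s.
Qed.
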